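(* Fix an integer $n\geq 1$. Let $X_n=[\overline{a_1,a_2,a_3}]$ be a continued fraction of type $(0,3)$ with $a_1,a_2,a_3\in\mathbb{Z}[X_{n-1}]$. Then there exists $\varepsilon\in RE_n^-$ such that $a_1=(X_n^2q(\varepsilon)-1)/p(\varepsilon)$, $a_2=p(\varepsilon)$, $a_3=(q(\varepsilon)-1)/p(\varepsilon)$, and $p(\varepsilon)q(\varepsilon)>0$. Conversely, if $\varepsilon\in RE_n^-$ satisfies $p(\varepsilon)\mid X_n^2q(\varepsilon)-1$ and $p(\varepsilon)\mid q(\varepsilon)-1$ in $\mathbb{Z}[X_{n-1}]$ and $p(\varepsilon)q(\varepsilon)>0$, then $$X_n=\left[\overline{\frac{X_n^2q(\varepsilon)-1}{p(\varepsilon)},\,p(\varepsilon),\,\frac{q(\varepsilon)-1}{p(\varepsilon)}}\right].$$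
   Context: For $m\geq 0$ let $X_m=2\cos(2\pi/2^{m+2})$ (so $X_0=0$ and $X_m=\sqrt{2+X_{m-1}}$), viewed as real numbers; $\mathbb{Z}[X_m]$ is the ring of integers of $\mathbb{Q}(X_m)$. Every $x\in\mathbb{Z}[X_n]$ can be written uniquely as $x=p(x)+X_nq(x)$ with $p(x),q(x)\in\mathbb{Z}[X_{n-1}]$. The relative norm is $N_{n/n-1}(x)=p(x)^2-X_n^2q(x)^2$, and $RE_n^-=\{\varepsilon\in\mathbb{Z}[X_n]: N_{n/n-1}(\varepsilon)=-1\}$. For a sequence $c_0,c_1,\dots$ in $\mathbb{Z}[X_{n-1}]$ define $p_k,q_k$ by $\begin{pmatrix}p_k & p_{k-1}\\ q_k & q_{k-1}\end{pmatrix}=\begin{pmatrix}c_0&1\\1&0\end{pmatrix}\cdots\begin{pmatrix}c_k&1\\1&0\end{pmatrix}$; $[c_0,c_1,\dots]$ denotes the real limit of $p_k/q_k$, and ''$X_n=[c_0,c_1,\dots]$'' means this limit exists and equals $X_n$. The notation $[\overline{c_1,c_2,c_3}]$ means the sequence $c_1,c_2,c_3,c_1,c_2,c_3,\dots$; a periodic sequence has type $(N,\ell)$ if $N\geq0$, $\ell\geq1$ are minimal with $c_{k+\ell}=c_k$ for all $k\geq N$. *)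

(* Defs.v *)
From mathcomp Require Import all_boot all_order all_algebra.
From mathcomp Require Import all_classical all_reals all_analysis.
Import Order.TTheory GRing.Theory Num.Theory.
Import numFieldNormedType.Exports.

Set Implicit Arguments.
Unset Strict Implicit.
Unset Printing Implicit Defensive.

Local Open Scope classical_set_scope.
Local Open Scope ring_scope.

Definition X (R : realType) (m : nat) : R := 2 * cos (2 * pi / 2 ^+ (m + 2)).

(* Z[X_m], as a subset of R *)
Definition ZX (R : realType) (m : nat) : set R :=
  [set x | exists f : {poly int}, x = (map_poly intr f).[X R m]].

Definition ZX_dvd (R : realType) (m : nat) (x y : R) : Prop :=
  exists2 d, ZX m d & y = x * d.

(* For n >= 1 and x in Z[X_n] there is exactly one such pair, and [get] picks
   it; the values of [pcoord] and [qcoord] elsewhere are irrelevant. *)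
Definition pqcoord (R : realType) (n : nat) (x : R) : R * R :=
  get [set u : R * R |
       [/\ ZX n.-1 u.1, ZX n.-1 u.2 & x = u.1 + X R n * u.2]].

Definition pcoord (R : realType) (n : nat) (x : R) : R := (pqcoord n x).1.
Definition qcoord (R : realType) (n : nat) (x : R) : R := (pqcoord n x).2.

Definition relnorm (R : realType) (n : nat) (x : R) : R :=
  pcoord n x ^+ 2 - X R n ^+ 2 * qcoord n x ^+ 2.

Definition REminus (R : realType) (n : nat) : set R :=
  [set e | ZX n e /\ relnorm n e = -1].

Definition cfmx (R : realType) (c : R) : 'M[R]_2 :=
  \matrix_(i < 2, j < 2) (nth [::] [:: [:: c; 1]; [:: 1; 0]] i)`_j.

Definition cfprod (R : realType) (c : nat -> R) (k : nat) : 'M[R]_2 :=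
  \prod_(i < k.+1) cfmx (c i).

Definition cfnum (R : realType) (c : nat -> R) (k : nat) : R := cfprod c k 0 0.
Definition cfden (R : realType) (c : nat -> R) (k : nat) : R := cfprod c k 1 0.

(* x = [c_0, c_1, ...].  The entries may be negative, so finitely many
   denominators may vanish; the quotients need only be eventually defined. *)
Definition is_cfrac (R : realType) (c : nat -> R) (x : R) : Prop :=
  (\forall k \near \oo, cfden c k != 0) /\
  (fun k => cfnum c k / cfden c k) @ \oo --> x.

(* the sequence s_0, ..., s_(l-1), s_0, ... where l = size s *)
Definition repeating (R : realType) (s : seq R) (k : nat) : R :=
  s`_(k %% size s).

Definition periodic_from (R : realType) (c : nat -> R) (N l : nat) : Prop :=
  forall k, (N <= k)%N -> c (k + l)%N = c k.

Definition has_type (R : realType) (c : nat -> R) (N l : nat) : Prop :=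
  [/\ (1 <= l)%N, periodic_from c N l &
      forall N' l', (1 <= l')%N -> periodic_from c N' l' ->
        (N <= N')%N /\ (l <= l')%N].

(* Main.v *)
(** The period matrix of [overline(a1, a2, a3)] is M = [[A, B], [C, a2]] with
    C = a2 a3 + 1, B = a1 a2 + 1 and det M = -1, and a limit X_n is fixed by M:
    C X_n^2 + (a2 - A) X_n - B = 0. Since 1 and X_n are independent over
    Z[X_(n-1)], this forces A = a2 and B = X_n^2 C, so that a2 + X_n C has
    relative norm det M = -1. Conversely, the matrix [[p, X_n^2 q], [q, p]] has
    eigenvalues p +- X_n q; iterating it gives convergence to X_n if p q > 0 and
    to - X_n if p q < 0. Independence amounts to 2 + X_m not being a square in
    the fraction field of Z[X_m], which descends by relative norms to the
    irrationality of sqrt 2. *)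
Require Import Defs.
From mathcomp Require Import all_boot all_order all_algebra.
From mathcomp Require Import all_classical all_reals all_analysis.
From mathcomp Require Import ring lra zify.
Import Order.TTheory GRing.Theory Num.Theory.
Import numFieldNormedType.Exports.

Local Open Scope classical_set_scope.
Local Open Scope ring_scope.

(** * The numbers X_m and closure properties of Z[X_m] *)

Section RingZX.
Variable R : realType.
Implicit Types (x y s t : R) (m : nat).

Lemma X0 : X R 0 = 0.
Proof.
rewrite /X add0n (_ : 2 * pi / 2 ^+ 2 = pi / 2); last by field.
by rewrite cos_pihalf mulr0.
Qed.

Lemma X_sqr m : X R m.+1 ^+ 2 = 2 + X R m.
Proof.
rewrite /X; set a := 2 * pi / 2 ^+ (m.+1 + 2).
have -> : 2 * pi / 2 ^+ (m + 2) = a *+ 2 :> R.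
  rewrite /a addSn exprS -mulr_natr; field.
  by rewrite expf_neq0 // pnatr_eq0.
rewrite cos_mulr2n; ring.
Qed.

Lemma X_ge0 m : 0 <= X R m.
Proof.
have p0 := pi_gt0 R.
rewrite /X mulr_ge0 // cos_ge0_pihalf //.
have h : (0 : R) < 2 ^+ (m + 2) by rewrite exprn_gt0.
apply/andP; split.
  by apply: (@le_trans _ _ 0); [lra | rewrite divr_ge0 // ?ltW //; lra].
rewrite ler_pdivrMr // exprD.
have : (1 : R) <= 2 ^+ m by rewrite exprn_ege1 // ler1n.
nra.
Qed.

Lemma X_gt0 m : 0 < X R m.+1.
Proof.
rewrite lt_def X_ge0 andbT; apply/eqP => h.
by have := X_sqr m; have := X_ge0 m; rewrite h; lra.
Qed.

Lemma ZX_int m (z : int) : ZX m (z%:~R : R).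
Proof. by exists z%:P; rewrite map_polyC hornerC. Qed.

Lemma ZX1 m : ZX m (1 : R).
Proof. exact: (ZX_int m 1). Qed.

Lemma ZX_X m : ZX m (X R m).
Proof. by exists 'X; rewrite map_polyX hornerX. Qed.

Lemma ZX_add m x y : ZX m x -> ZX m y -> ZX m (x + y).
Proof. by move=> [f ->] [g ->]; exists (f + g); rewrite rmorphD hornerD. Qed.

Lemma ZX_opp m x : ZX m x -> ZX m (- x).
Proof. by move=> [f ->]; exists (- f); rewrite rmorphN hornerN. Qed.

Lemma ZX_sub m x y : ZX m x -> ZX m y -> ZX m (x - y).
Proof. by move=> hx hy; apply: ZX_add => //; exact: ZX_opp. Qed.

Lemma ZX_mul m x y : ZX m x -> ZX m y -> ZX m (x * y).
Proof. by move=> [f ->] [g ->]; exists (f * g); rewrite rmorphM hornerM. Qed.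

Lemma ZX_sqrX m : ZX m (X R m.+1 ^+ 2).
Proof. by rewrite X_sqr; apply: ZX_add; [exact: (ZX_int m 2) | exact: ZX_X]. Qed.

End RingZX.

Ltac zx := repeat first [assumption | exact: ZX_sqrX | apply: ZX_sub
  | apply: ZX_add | apply: ZX_mul].

(** * Linear independence of 1 and X_(m+1) over Z[X_m] *)

Section Independence.
Variable R : realType.
Implicit Types (x s t : R) (m : nat).

(** Horner induction: multiplying s + X_(m+1) t by X_(m+1) swaps the two components up to the factor
    X_(m+1)^2, which lies in Z[X_m]. *)
Lemma ZX_split m x : ZX m.+1 x ->
  exists s t, [/\ ZX m s, ZX m t & x = s + X R m.+1 * t].
Proof.
move=> [f ->]; elim/poly_ind: f => [|f z [s [t [hs ht E]]]].
  exists 0, 0; rewrite rmorph0 horner0 mulr0 addr0.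
  by split=> //; exact: (ZX_int R m 0).
exists (X R m.+1 ^+ 2 * t + z%:~R), s; split => //.
  by apply: ZX_add; [apply: ZX_mul => //; exact: ZX_sqrX | exact: ZX_int].
rewrite rmorphD rmorphM /= map_polyX map_polyC hornerMXaddC E /=; ring.
Qed.

Lemma ZX_succ m x : ZX m x -> ZX m.+1 x.
Proof.
move=> [f ->]; elim/poly_ind: f => [|f z IH].
  by rewrite rmorph0 horner0; exact: (ZX_int _ _ 0).
rewrite rmorphD rmorphM /= map_polyX map_polyC hornerMXaddC /=.
apply: ZX_add; last exact: ZX_int.
apply: ZX_mul => //.
have -> : X R m = X R m.+1 * X R m.+1 - 2%:~R by rewrite -expr2 X_sqr; ring.
apply: ZX_sub; last exact: ZX_int.
by apply: ZX_mul; exact: ZX_X.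
Qed.

Lemma ZX0_int x : ZX 0 x -> exists z : int, x = z%:~R.
Proof.
by move=> [f ->]; exists f`_0; rewrite X0 horner_coef0 coef_map.
Qed.

(** For b nonzero, the exponent of 2 would be even on the left and odd on the right. *)
Lemma int_sqr_eq2 (a b : int) : a ^+ 2 = 2 * b ^+ 2 -> b = 0.
Proof.
move=> E; apply/eqP; rewrite -absz_eq0; apply: contraT; rewrite -lt0n => b0.
have E' : (`|a| ^ 2 = 2 * `|b| ^ 2)%N by rewrite -!abszX E abszM.
move/(congr1 (logn 2)): E'.
rewrite lognM ?expn_gt0 ?b0 // !lognX (logn_prime 2 (isT : prime 2)) eqxx.
lia.
Qed.

(** Denominator-free form of: c is not a square in the fraction field of Z[X_m]. *)
Definition nonsquare_at m (c : R) :=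
  forall s t, ZX m s -> ZX m t -> s ^+ 2 = c * t ^+ 2 -> t = 0.

(** A relation with t nonzero would make X_(m+1)^2 = 2 + X_m the square of -s/t. *)
Lemma ZX_indep_of_nonsquare m s t : nonsquare_at m (2 + X R m) ->
  ZX m s -> ZX m t -> s + X R m.+1 * t = 0 -> s = 0 /\ t = 0.
Proof.
move=> H hs ht E.
have t0 : t = 0.
  apply: (H s) => //; rewrite -X_sqr.
  have -> : s = - (X R m.+1 * t) by apply/eqP; rewrite -addr_eq0 E.
  ring.
by move: E; rewrite t0 mulr0 addr0.
Qed.

(* The conjugation X_(m+1) |-> - X_(m+1) and the relative norm carry an equation
   s^2 = (2 +- X_(m+1)) t^2 down to S^2 = (2 - X_m) T^2; hence both signs. *)
Lemma nonsquare_2pmX m :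
  nonsquare_at m (2 + X R m) /\ nonsquare_at m (2 - X R m).
Proof.
elim: m => [|m [IHp IHm]].
  suff h : nonsquare_at 0 2 by rewrite X0 subr0 addr0.
  move=> s t /ZX0_int[a ->] /ZX0_int[b ->] E.
  suff -> : b = 0 by [].
  apply: (@int_sqr_eq2 a); apply: (@intr_inj R).
  by rewrite [in RHS]rmorphM /= !rmorphXn.
have main (w : R) : w = 1 \/ w = - 1 -> nonsquare_at m.+1 (2 + w * X R m.+1).
  move=> hw s t /ZX_split[a [b [ha hb ->]]] /ZX_split[c [d [hc hd ->]]] E.
  set Y := X R m.+1 in E *.
  have hY : Y ^+ 2 = 2 + X R m := X_sqr R m.
  have w2 : w ^+ 2 = 1 by case: hw => ->; ring.
  have hw' : ZX m w.
    by case: hw => ->; [exact: ZX1 | apply: ZX_opp; exact: ZX1].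
  have h2 : ZX m (2 : R) by exact: (ZX_int R m 2).
  (* Both components of [E] over Z[X_m] vanish; this is what allows conjugating [E] below. *)
  have [] := @ZX_indep_of_nonsquare m
    (a * a + Y ^+ 2 * (b * b)
      - (2 * (c * c + Y ^+ 2 * (d * d)) + w * (Y ^+ 2 * (2 * (c * d)))))
    (2 * (a * b) - (2 * (2 * (c * d)) + w * (c * c + Y ^+ 2 * (d * d)))) IHp.
  - by zx.
  - by zx.
  - by move/eqP: E; rewrite -subr_eq0 => /eqP <-; rewrite -/Y; ring.
  move=> E1 E2.
  have Econj : (a - Y * b) ^+ 2 = (2 - w * Y) * (c - Y * d) ^+ 2.
    apply/eqP; rewrite -subr_eq0; apply/eqP.
    transitivity ((a * a + Y ^+ 2 * (b * b)
      - (2 * (c * c + Y ^+ 2 * (d * d)) + w * (Y ^+ 2 * (2 * (c * d)))))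
      - Y * (2 * (a * b) - (2 * (2 * (c * d)) + w * (c * c + Y ^+ 2 * (d * d))))).
      ring.
    by rewrite E1 E2; ring.
  (* Multiplying [E] by its conjugate, with (2 + wY)(2 - wY) = 4 - Y^2 = 2 - X_m, puts the norms
     under [IHm]. *)
  have N0 : c * c - Y ^+ 2 * (d * d) = 0.
    apply: (IHm (a * a - Y ^+ 2 * (b * b))).
    - by zx.
    - by zx.
    transitivity ((a + Y * b) ^+ 2 * (a - Y * b) ^+ 2); first by ring.
    rewrite E Econj.
    have -> : 2 - X R m = 4 - w ^+ 2 * Y ^+ 2 by rewrite hY w2; ring.
    ring.
  (* A zero norm reads c^2 = (2 + X_m) d^2, which [IHp] excludes unless d = 0. *)
  have d0 : d = 0.
    by apply: (IHp c) => //; rewrite -hY; apply/eqP; rewrite -subr_eq0 !expr2 N0.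
  move: N0; rewrite d0 !mulr0 subr0 addr0 => /eqP.
  by rewrite mulf_eq0 orbb => /eqP.
split; first by rewrite -[X R m.+1]mul1r; apply: main; left.
by rewrite -mulN1r; apply: main; right.
Qed.

Lemma ZX_indep m s t : ZX m s -> ZX m t -> s + X R m.+1 * t = 0 ->
  s = 0 /\ t = 0.
Proof. by move=> hs ht; apply: ZX_indep_of_nonsquare => //; case: (nonsquare_2pmX m). Qed.

(** By independence, the pair chosen by [get] is the only candidate. *)
Lemma pqcoord_eq m s t : ZX m s -> ZX m t ->
  pqcoord m.+1 (s + X R m.+1 * t) = (s, t).
Proof.
move=> hs ht; rewrite /pqcoord /=; case: xgetP => [[p q] _ /= [hp hq E]|]; last first.
  by move=> /(_ (s, t)) /=; case.
have [] := @ZX_indep m (s - p) (t - q); [exact: ZX_sub | exact: ZX_sub | |].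
  apply/eqP; move/eqP: E; rewrite -subr_eq0 => /eqP <-; apply/eqP; ring.
by move=> /eqP + /eqP; rewrite !subr_eq0 => /eqP -> /eqP ->.
Qed.

End Independence.

(** * Convergents of 3-periodic continued fractions and their limits *)

Section ContinuedFraction.
Variable R : realType.
Implicit Types (c u v : nat -> R) (a b x y p q : R).

Lemma cfmx_mulE a (B : 'M[R]_2) :
  (cfmx a * B) 0 0 = a * B 0 0 + B 1 0 /\ (cfmx a * B) 1 0 = B 0 0.
Proof.
by rewrite !mxE !big_ord_recl !big_ord0 !mxE /= !mul0r !mul1r !addr0;
  rewrite (_ : lift 0 0 = 1) //; apply: val_inj.
Qed.

(** Factors are peeled off at the front, so that after three of them a 3-periodic sequence returns
    to itself. *)
Lemma cfprodS c k : cfprod c k.+1 = cfmx (c 0) * cfprod (c \o S) k.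
Proof. by rewrite /cfprod big_ord_recl. Qed.

Lemma cfnumS c k : cfnum c k.+1 = c 0 * cfnum (c \o S) k + cfden (c \o S) k.
Proof. by rewrite /cfnum cfprodS (cfmx_mulE _ _).1. Qed.

Lemma cfdenS c k : cfden c k.+1 = cfnum (c \o S) k.
Proof. by rewrite /cfden cfprodS (cfmx_mulE _ _).2. Qed.

Lemma cfnum0 c : cfnum c 0 = c 0.
Proof. by rewrite /cfnum /cfprod big_ord1 mxE. Qed.

Lemma cfden0 c : cfden c 0 = 1.
Proof. by rewrite /cfden /cfprod big_ord1 mxE. Qed.

Lemma repeating3_shift a1 a2 a3 :
  ((repeating [:: a1; a2; a3] \o S) \o S) \o S = repeating [:: a1; a2; a3].
Proof.
by apply/funext => k; rewrite /= /repeating /= -addn3 modnDr.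
Qed.

(** Top row of the period matrix applied to the column of the k-th convergent; [cfden_rep3] is the
    bottom row. *)
Lemma cfnum_rep3 a1 a2 a3 k (c := repeating [:: a1; a2; a3]) :
  cfnum c (k + 3) = (a1 * a2 * a3 + a1 + a3) * cfnum c k
                    + (a1 * a2 + 1) * cfden c k.
Proof.
rewrite addn3 cfnumS cfdenS !cfnumS !cfdenS repeating3_shift -/c.
rewrite /= /c /repeating /=; ring.
Qed.

Lemma cfden_rep3 a1 a2 a3 k (c := repeating [:: a1; a2; a3]) :
  cfden c (k + 3) = (a2 * a3 + 1) * cfnum c k + a2 * cfden c k.
Proof.
rewrite addn3 cfdenS cfnumS !cfdenS !cfnumS repeating3_shift -/c.
rewrite /= /c /repeating /=; ring.
Qed.

(** Each residue class mod 3 is geometric of ratio rho; K dominates the three initial terms. *)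
Lemma cvg0_geo3 u (rho : R) : `|rho| < 1 ->
  (forall k, u (k + 3) = rho * u k) -> u @ \oo --> (0 : R).
Proof.
move=> hrho hu; pose K := `|u 0| + `|u 1| + `|u 2|.
have bound k : `|u k| <= K * `|rho| ^+ (k %/ 3).
  elim/ltn_ind: k => -[|[|[|k]]] IH.
  - by rewrite expr0 mulr1 /K -addrA lerDl addr_ge0.
  - by rewrite expr0 mulr1 /K -addrA addrCA lerDl addr_ge0.
  - by rewrite expr0 mulr1 /K lerDr addr_ge0.
  rewrite -addn3 hu normrM divnDr // divnn addn1 exprS mulrCA.
  by apply: ler_wpM2l => //; apply: IH; lia.
apply: norm_cvg0.
apply: (@squeeze_cvgr _ _ _ _ (fun=> 0) (fun k => K * `|rho| ^+ (k %/ 3))).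
- by apply: nearW => k; rewrite normr_ge0 bound.
- exact: cvg_cst.
rewrite -[X in _ --> X](mulr0 K); apply: cvgMl_tmp.
apply: (@cvg_comp _ _ _ (fun k => k %/ 3)%N (fun j => `|rho| ^+ j) \oo \oo).
  move=> A [N _ hN]; exists (3 * N)%N => // k /= hk; apply: hN => /=; lia.
by apply: cvg_expr; rewrite normr_id.
Qed.

(* The matrix [[p, q y^2], [q, p]] has eigenvalues p +- q y, read off on the
   linear forms u +- y v; when p q y > 0 the form u + y v dominates. *)
Lemma cvg_ratio u v p q y : y != 0 -> 0 < p * q * y ->
    (forall k, u (k + 3) = p * u k + y ^+ 2 * q * v k) ->
    (forall k, v (k + 3) = q * u k + p * v k) ->
    (forall k, (k < 3)%N -> u k + y * v k != 0) ->
  (\forall k \near \oo, v k != 0) /\ (fun k => u k / v k) @ \oo --> y.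
Proof.
move=> y0 pqy hu hv h3.
have lmu : (p - q * y) ^+ 2 < (p + q * y) ^+ 2.
  by rewrite -subr_gt0 (_ : _ - _ = 4 * (p * q * y)); [rewrite mulr_gt0 | ring].
have l0 : p + q * y != 0.
  apply/eqP => l0; move: lmu; rewrite l0 expr0n /= ltNge.
  by rewrite sqr_ge0.
(* The form u + y v is multiplied by p + q y at each period, so nonvanishing propagates from the
   first three indices. *)
have wp0 k : u k + y * v k != 0.
  elim/ltn_ind: k => k IH; case: (ltnP k 3) => [/h3 //|k3].
  rewrite -(subnK k3) hu hv.
  set j := (k - 3)%N.
  have -> : p * u j + y ^+ 2 * q * v j + y * (q * u j + p * v j)
     = (p + q * y) * (u j + y * v j) by ring.
  by rewrite mulf_neq0 // IH // /j; lia.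
(* The ratio of the two eigenforms contracts by (p - q y)/(p + q y) per period, and u/v = y (1 +
   r)/(1 - r). *)
pose r k := (u k - y * v k) / (u k + y * v k).
have r0 : r @ \oo --> (0 : R).
  apply: (@cvg0_geo3 _ ((p - q * y) / (p + q * y))).
    rewrite normrM normfV ltr_pdivrMr ?normr_gt0 // mul1r.
    by rewrite -(@ltr_pXn2r _ 2%N) ?nnegrE ?normr_ge0 // !real_normK ?num_real.
  move=> k; rewrite /r hu hv.
  have -> : p * u k + y ^+ 2 * q * v k + y * (q * u k + p * v k)
     = (p + q * y) * (u k + y * v k) by ring.
  have -> : p * u k + y ^+ 2 * q * v k - y * (q * u k + p * v k)
     = (p - q * y) * (u k - y * v k) by ring.
  by rewrite mulf_div.
have vE k : 2 * (y * v k) = (1 - r k) * (u k + y * v k).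
  by rewrite /r mulrBl divfK // mul1r; ring.
have uE k : 2 * u k = (1 + r k) * (u k + y * v k).
  by rewrite /r [RHS]mulrDl divfK // mul1r; ring.
have r1 : \forall k \near \oo, 1 - r k != 0.
  near=> k; have : `|r k| < 1 by near: k; exact: cvgr0_norm_lt.
  rewrite subr_eq0; apply: contraTneq => <-; by rewrite normr1 ltxx.
have v0 : \forall k \near \oo, v k != 0.
  near=> k; have rk : 1 - r k != 0 by near: k.
  apply/eqP => vk; have /eqP := vE k.
  by rewrite {1}vk !mulr0 eq_sym mulf_eq0 (negPf rk) (negPf (wp0 k)).
split=> //.
have lim : (fun k => y * ((1 + r k) / (1 - r k))) @ \oo --> y.
  rewrite -[X in _ --> X]mulr1; apply: cvgMl_tmp.
  rewrite [X in _ --> X](_ : 1 = (1 + 0) / (1 - 0)); last first.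
    by rewrite addr0 subr0 divr1.
  apply: cvgM; first by apply: cvgD => //; exact: cvg_cst.
  apply: cvgV; first by rewrite subr0 oner_neq0.
  by apply: cvgB => //; exact: cvg_cst.
apply: cvg_trans lim; apply: near_eq_cvg; near=> k.
have rk : 1 - r k != 0 by near: k.
have vk : v k != 0 by near: k.
rewrite /=; apply: (mulIf vk); rewrite divfK //; apply: (mulIf rk).
have -> : y * ((1 + r k) / (1 - r k)) * v k * (1 - r k) = (1 + r k) * (y * v k).
  by field.
apply: (@mulfI _ 2) => //; rewrite mulrCA vE mulrA uE; ring.
Unshelve. all: by end_near.
Qed.

(** Limit of the recurrence linking r_(k+3) to r_k, with denominators cleared so that no
    nonvanishing at x is required. *)
Lemma cfrac_rep3_fixpoint a1 a2 a3 x :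
  is_cfrac (repeating [:: a1; a2; a3]) x ->
  (a1 * a2 * a3 + a1 + a3) * x + (a1 * a2 + 1) = x * ((a2 * a3 + 1) * x + a2).
Proof.
set c := repeating _; move=> [d0 cx].
pose r k := cfnum c k / cfden c k.
have cx3 : (fun k => r (k + 3)%N) @ \oo --> x by rewrite (cvg_shiftn 3 r).
have cl : (fun k => (a1 * a2 * a3 + a1 + a3) * r k + (a1 * a2 + 1)) @ \oo -->
    (a1 * a2 * a3 + a1 + a3) * x + (a1 * a2 + 1).
  by apply: cvgD; [exact: (cvgMl_tmp cx) | exact: cvg_cst].
have cr : (fun k => r (k + 3)%N * ((a2 * a3 + 1) * r k + a2)) @ \oo -->
    x * ((a2 * a3 + 1) * x + a2).
  by apply: cvgM => //; apply: cvgD; [exact: (cvgMl_tmp cx) | exact: cvg_cst].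
apply: (cvg_unique (@norm_hausdorff _ _) cl); apply: cvg_trans cr; apply: near_eq_cvg.
have d3 : \forall k \near \oo, cfden c (k + 3) != 0.
  by case: d0 => N _ hN; exists N => // k /= hk; apply: hN => /=; lia.
near=> k.
have dk : cfden c k != 0 by near: k.
have : cfden c (k + 3) != 0 by near: k.
rewrite /r cfnum_rep3 cfden_rep3 -/c => dk3.
by field; rewrite dk.
Unshelve. all: by end_near.
Qed.

(** The two equations give the period matrix the shape treated in [cvg_ratio]; the last two
    conditions are its starting conditions at k = 0 and k = 1. The sign of y is left free so that y
    = - X_n can be tested too. *)
Lemma is_cfrac_rep3 a1 a2 a3 y : y != 0 ->
    a1 * a2 * a3 + a1 + a3 = a2 -> a1 * a2 + 1 = y ^+ 2 * (a2 * a3 + 1) ->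
    0 < a2 * (a2 * a3 + 1) * y ->
    a1 + y != 0 -> a1 * a2 + 1 + y * a2 != 0 ->
  is_cfrac (repeating [:: a1; a2; a3]) y.
Proof.
move=> y0 hA hB pos h0 h1; set c := repeating _.
apply: (@cvg_ratio (cfnum c) (cfden c) a2 (a2 * a3 + 1) y) => //.
- by move=> k; rewrite cfnum_rep3 hA hB.
- by move=> k; rewrite cfden_rep3.
move=> [|[|[|//]]] _.
- by rewrite cfnum0 cfden0 mulr1.
- by rewrite cfnumS cfdenS cfnum0 cfden0.
(* At k = 2 the form is a2 + y q with q = a2 a3 + 1; if it vanished, a2 q y = -(q y)^2 would not be
   positive. *)
rewrite !(cfnumS, cfdenS) cfnum0 cfden0 /=.
rewrite /c /repeating /= (_ : _ + _ = a2 + y * (a2 * a3 + 1)); last first.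
  by rewrite -[X in _ = X + _]hA; ring.
apply: contraTneq pos => /eqP; rewrite addr_eq0 => /eqP e.
rewrite -leNgt -mulrA [_ * y]mulrC {1}e mulNr oppr_le0.
by rewrite -expr2 sqr_ge0.
Qed.

End ContinuedFraction.

(** * Correspondence between 3-periodic expansions of X_n and elements of relative norm -1 *)

Theorem theorem3p3 (R : realType) (n : nat) (hn : (1 <= n)%N) :
  (forall a1 a2 a3 : R,
      ZX n.-1 a1 -> ZX n.-1 a2 -> ZX n.-1 a3 ->
      has_type (repeating [:: a1; a2; a3]) 0 3 ->
      is_cfrac (repeating [:: a1; a2; a3]) (X R n) ->
      exists2 e : R, REminus n e &
        [/\ a1 = (X R n ^+ 2 * qcoord n e - 1) / pcoord n e,
            a2 = pcoord n e,
            a3 = (qcoord n e - 1) / pcoord n e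
          & 0 < pcoord n e * qcoord n e])
  /\
  (forall e : R, REminus n e ->
      ZX_dvd n.-1 (pcoord n e) (X R n ^+ 2 * qcoord n e - 1) ->
      ZX_dvd n.-1 (pcoord n e) (qcoord n e - 1) ->
      0 < pcoord n e * qcoord n e ->
      is_cfrac
        (repeating [:: (X R n ^+ 2 * qcoord n e - 1) / pcoord n e;
                       pcoord n e;
                       (qcoord n e - 1) / pcoord n e])
        (X R n)).
Proof.
case: n hn => // m _; rewrite [m.+1.-1]/=.
set x := X R m.+1.
have x0 : 0 < x := X_gt0 R m.
have xn0 : x != 0 by rewrite gt_eqF.
have xx : ZX m (x ^+ 2) := ZX_sqrX R m.
have h1 : ZX m (1 : R) := ZX1 R m.
split.
  move=> a1 a2 a3 z1 z2 z3 _ hcf.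
  have fix_x := @cfrac_rep3_fixpoint _ _ _ _ _ hcf.
  have [] := @ZX_indep R m (a1 * a2 + 1 - x ^+ 2 * (a2 * a3 + 1))
                (a1 * a2 * a3 + a1 + a3 - a2).
  - by zx.
  - by zx.
  - move/eqP: fix_x; rewrite -subr_eq0 -/x => /eqP <-; ring.
  move=> /eqP; rewrite subr_eq0 => /eqP hB /eqP; rewrite subr_eq0 => /eqP hA.
  (* With a2 = 0, [hB] would say 1 = x^2 = 2 + X_m, which is at least 2. *)
  have a20 : a2 != 0.
    apply/eqP => a20; move: hB; rewrite a20 mul0r mulr0 add0r mulr1 X_sqr.
    by have := X_ge0 R m; lra.
  set q := a2 * a3 + 1 in hB.
  have zq : ZX m q by apply: ZX_add => //; exact: ZX_mul.
  have pqE := pqcoord_eq _ _ _ _ z2 zq.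
  (* The left side is the determinant of the period matrix, by [hA] and [hB]. *)
  have nrm : a2 ^+ 2 - x ^+ 2 * q ^+ 2 = -1.
    rewrite [q ^+ 2]expr2 mulrA -hB expr2 -[X in X * _ - _]hA /q; ring.
  have q0 : q != 0.
    apply/eqP => q0; move: nrm; rewrite q0 expr0n /= mulr0 subr0.
    by have := sqr_ge0 a2; lra.
  exists (a2 + x * q).
    split; last by rewrite /relnorm /pcoord /qcoord pqE.
    by apply: ZX_add; [|apply: ZX_mul; [exact: ZX_X|]]; exact: ZX_succ.
  rewrite /pcoord /qcoord pqE /=; split=> //.
  - by rewrite -hB addrK mulfK.
  - by rewrite /q addrK [a2 * _]mulrC mulfK.
  (* If a2 q < 0, the same expansion also converges to -x, against uniqueness of limits. The
     starting conditions at -x follow from independence. *)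
  rewrite lt_neqAle eq_sym mulf_neq0 // leNgt; apply/negP => neg.
  have [|||||_ cN] := @is_cfrac_rep3 R a1 a2 a3 (- x) _ hA.
  - by rewrite oppr_eq0.
  - by rewrite sqrrN.
  - by rewrite mulrN oppr_gt0 pmulr_llt0.
  - apply/eqP => e; have [] := @ZX_indep R m a1 (-1) z1.
    + exact: ZX_opp.
    + by rewrite mulrN1.
    + by move=> _ /eqP; rewrite oppr_eq0 oner_eq0.
  - apply/eqP => e; have [] := @ZX_indep R m (a1 * a2 + 1) (- a2).
    + by apply: ZX_add => //; exact: ZX_mul.
    + exact: ZX_opp.
    + by rewrite -/x -e; ring.
    + by move=> _ /eqP; rewrite oppr_eq0 (negPf a20).
  have : x = - x by apply: (cvg_unique (@norm_hausdorff _ _) hcf.2 cN).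
  lra.
move=> e [_]; rewrite /relnorm -/x.
set p := pcoord _ _; set q := qcoord _ _ => nrm [d1 z1 e1] [d3 z3 e3] pq.
have p0 : p != 0 by apply: contraTneq pq => ->; rewrite mul0r ltxx.
have -> : (q - 1) / p = d3 by rewrite e3 [p * _]mulrC mulfK.
have -> : (x ^+ 2 * q - 1) / p = d1 by rewrite e1 [p * _]mulrC mulfK.
have hq : p * d3 + 1 = q by rewrite -e3 subrK.
have hB : d1 * p + 1 = x ^+ 2 * q by rewrite mulrC -e1 subrK.
(* It is a factor of the norm, which is -1. *)
have l0 : p + x * q != 0.
  apply/eqP => l0; move: nrm.
  rewrite (_ : _ - _ = (p + x * q) * (p - x * q)); last by ring.
  by rewrite l0 mul0r; lra.
apply: is_cfrac_rep3; rewrite ?hq ?hB //.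
(* After multiplication by p, the upper left entry becomes (d1 p + 1)(p d3 + 1) - 1 = x^2 q^2 - 1,
   which is p^2 by the norm equation. *)
- apply: (mulIf p0); transitivity (x ^+ 2 * q ^+ 2 - 1).
    rewrite -[X in _ = X - _](_ : (d1 * p + 1) * (p * d3 + 1) = _).
      by ring.
    by rewrite hB hq; ring.
  by move: nrm; rewrite expr2; lra.
- by rewrite mulr_gt0.
- apply/eqP => e0; have [] := @ZX_indep R m d1 1 z1 h1.
    by rewrite mulr1.
  by move=> _ /eqP; rewrite oner_eq0.
have -> : x ^+ 2 * q + x * p = x * (p + x * q) by ring.
by rewrite mulf_neq0.
Qed.
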